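(* In the category $\mathrm{Def}$ of definable spaces and continuous definable maps the following hold: (1) Closed immersions are proper in $\mathrm{Def}$. (2) A composition of two morphisms proper in $\mathrm{Def}$ is proper in $\mathrm{Def}$. (3) Let $p:X\to Z$, $q:Y\to Z$ and $f:X\to Y$ be morphisms in $\mathrm{Def}$ with $q\circ f=p$, and let $Z'\to Z$ be a morphism in $\mathrm{Def}$. If $f$ is proper in $\mathrm{Def}$, then the base extension morphism $f'=f\times\mathrm{id}_{Z'}:X\times_Z Z'\to Y\times_Z Z'$ is proper in $\mathrm{Def}$. (4) Let $p:X\to Z$, $q:Y\to Z$, $f:X\to Y$ with $q\circ f=p$, and $p':X'\to Z$, $q':Y'\to Z$, $f':X'\to Y'$ with $q'\circ f'=p'$, be morphisms in $\mathrm{Def}$. If $f$ and $f'$ are proper in $\mathrm{Def}$, then the product morphism $f\times f':X\times_Z X'\to Y\times_Z Y'$ is proper in $\mathrm{Def}$. (5) If $f:X\to Y$ and $g:Y\to Z$ are morphisms in $\mathrm{Def}$ such that $g\circ f$ is proper in $\mathrm{Def}$, then: (i) $f$ is proper in $\mathrm{Def}$; (ii) if $g$ is separated in $\mathrm{Def}$ and $f$ is surjective, then $g$ is proper in $\mathrm{Def}$. (6) A morphism $f:X\to Y$ is proper in $\mathrm{Def}$ if and only if $Y$ can be covered by finitely many open definable subsets $V_i$ such that each restriction $f_|:f^{-1}(V_i)\to V_i$ is proper in $\mathrm{Def}$.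
   Context: $\mathbb M=(M,<,\ldots)$ is an o-minimal structure; ''definable'' means definable in $\mathbb M$, possibly with parameters. A definable space is a set $X=\bigcup_{i\le k}X_i$ with injections (definable charts) $\theta_i:X_i\to M^{n_i}$ ($i\le k$, $k$ finite) such that each $\theta_i(X_i)$ is a definable subset of $M^{n_i}$ (with the induced topology), each $\theta_i(X_i\cap X_j)$ is an open definable subset of $\theta_i(X_i)$, and each transition map $\theta_j\circ\theta_i^{-1}:\theta_i(X_i\cap X_j)\to\theta_j(X_i\cap X_j)$ is a definable homeomorphism. $X$ carries the topology in which each $X_i$ is open and each $\theta_i$ is a homeomorphism. A subset $A\subseteq X$ is definable if each $\theta_i(A\cap X_i)$ is definable; it is then itself a definable space with the induced topology. A map $f:X\to Y$ between definable spaces with charts $(X_i,\theta_i)$, $(Y_j,\delta_j)$ is definable if each $\delta_j\circ f\circ\theta_i^{-1}$ (on its natural domain) is a definable map between definable sets. $\mathrm{Def}$ is the category of definable spaces with continuous definable maps. For morphisms $f:X\to Z$, $g:Y\to Z$ in $\mathrm{Def}$, the cartesian square is given by the fiber product $X\times_Z Y=\{\langle x,y\rangle\in X\times Y: f(x)=g(y)\}$ with the restricted projections. A morphism $f:X\to Y$ in $\mathrm{Def}$ is: - closed in $\mathrm{Def}$ if $f(A)$ is closed in $Y$ for every closed definable subset $A\subseteq X$; - a closed immersion if $f:X\to f(X)$ is a homeomorphism and $f(X)$ is closed in $Y$; - separated in $\mathrm{Def}$ if the diagonal morphism $\Delta:X\to X\times_Y X$, $x\mapsto\langle x,x\rangle$,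 is a closed immersion; - universally closed in $\mathrm{Def}$ if for every morphism $g:Y'\to Y$ in $\mathrm{Def}$ the projection $X\times_Y Y'\to Y'$ is closed in $\mathrm{Def}$; - proper in $\mathrm{Def}$ if it is separated and universally closed in $\mathrm{Def}$.
   Formalization: In (5)(i) the formal statement additionally assumes that g is separated in Def; without it the claim fails, e.g. for the inclusion f of one chart into the line with a doubled point and g the collapse onto the line. *)

(* Defs.v *)
From HB Require Import structures.
From mathcomp Require Import all_boot all_order all_algebra all_classical.
From mathcomp Require Import topology.
Set Implicit Arguments.
Unset Strict Implicit.
Unset Printing Implicit Defensive.

Local Open Scope ring_scope.
Local Open Scope classical_set_scope.

Record language := Language { fsym : nat -> Type ; rsym : nat -> Type }.

Inductive term (L : language) (V : Type) : Type :=
| Var of V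
| App n of fsym L n & ('I_n -> term L V).

(* The order symbol is a logical symbol: every structure below is an expansion
   of a linear order.  [Ex] binds the variable [None]. *)
Inductive formula (L : language) (V : Type) : Type :=
| Eq of term L V & term L V
| Lt of term L V & term L V
| Rel n of rsym L n & ('I_n -> term L V)
| Not of formula L V
| And of formula L V & formula L V
| Ex of formula L (option V).

Record interpretation (L : language) (M : Type) := Interpretation {
  ifun : forall n, fsym L n -> ('I_n -> M) -> M ;
  irel : forall n, rsym L n -> ('I_n -> M) -> Prop }.

Definition ocons (V M : Type) (a : M) (v : V -> M) : option V -> M :=
  fun u => if u is Some w then v w else a.

Section Sat.
Context (L : language) {d : Order.disp_t} {M : orderType d}.
Variable I : interpretation L M.

Fixpoint eval V (v : V -> M) (t : term L V) : M :=
  match t with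
  | Var x => v x
  | App _ f ts => ifun I f (fun i => eval v (ts i))
  end.

Fixpoint sat V (v : V -> M) (phi : formula L V) {struct phi} : Prop :=
  match phi with
  | Eq s t => eval v s = eval v t
  | Lt s t => (eval v s < eval v t)%O
  | Rel _ r ts => irel I r (fun i => eval v (ts i))
  | Not psi => ~ sat v psi
  | And psi1 psi2 => sat v psi1 /\ sat v psi2
  | Ex psi => exists a : M, sat (ocons a v) psi
  end.

(* A variable of the form [inr a] is the parameter [a] : M. *)
Definition with_params V (v : V -> M) : V + M -> M :=
  fun u => match u with inl x => v x | inr a => a end.

Definition definable n (A : set 'rV[M]_n) : Prop :=
  exists phi : formula L ('I_n + M),
    forall x : 'rV[M]_n, A x <-> sat (with_params (x ord0)) phi.

End Sat.

(* [interval] covers points, bounded and unbounded intervals, with or without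
   their endpoints; the order is not required to be dense. *)
Record omin_structure := OminStructure {
  odisp : Order.disp_t ;
  ocarrier :> orderTopologicalType odisp ;
  olang : language ;
  ointerp : interpretation olang ocarrier ;
  o_minimal : forall A : set ocarrier,
    definable ointerp [set x : 'rV[ocarrier]_1 | A (x ord0 ord0)] ->
    exists s : seq (interval ocarrier),
      A = [set x | exists2 J, J \in s & x \in J] }.

Definition mdefinable (M : omin_structure) n (A : set 'rV[M]_n) : Prop :=
  definable (ointerp M) A.

Definition homeomorphism (S T : topologicalType) (h : S -> T) : Prop :=
  continuous h /\
  exists g : T -> S, [/\ continuous g, cancel h g & cancel g h].

Definition corestrict (S T : Type) (f : S -> T) (x : S) : range f :=
  SigSub (mem_set (imageT f x)).

Definition homeo_onto_image (S T : topologicalType) (f : S -> T) : Prop :=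
  homeomorphism (corestrict f).

(* [ds_chart i] is total for convenience; only its restriction to [ds_dom i]
   is meaningful.  The topology of the carrier is part of the data, and the
   axioms [ds_dom_open] and [ds_chart_homeo] say that it is the one determined
   by the atlas. *)
Record dspace (M : omin_structure) := DSpace {
  ds_carrier :> topologicalType ;
  ds_index : finType ;
  ds_dim : ds_index -> nat ;
  ds_dom : ds_index -> set ds_carrier ;
  ds_chart : forall i, ds_carrier -> 'rV[M]_(ds_dim i) ;
  ds_cover : \bigcup_i ds_dom i = setT ;
  ds_chart_inj : forall i, {in ds_dom i &, injective (@ds_chart i)} ;
  ds_chart_def : forall i, mdefinable (@ds_chart i @` ds_dom i) ;
  ds_overlap_def : forall i j,
    mdefinable (@ds_chart i @` (ds_dom i `&` ds_dom j)) ;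
  ds_overlap_open : forall i j, exists2 U : set 'rV[M]_(ds_dim i), open U &
    @ds_chart i @` (ds_dom i `&` ds_dom j) = U `&` @ds_chart i @` ds_dom i ;
  ds_transition_def : forall i j,
    mdefinable ((fun x => row_mx (@ds_chart i x) (@ds_chart j x))
                  @` (ds_dom i `&` ds_dom j)) ;
  ds_transition_homeo : forall i j,
    exists h : (@ds_chart i @` (ds_dom i `&` ds_dom j)) ->
               (@ds_chart j @` (ds_dom i `&` ds_dom j)),
      homeomorphism h /\
      forall a x, (ds_dom i `&` ds_dom j) x ->
        @ds_chart i x = set_val a -> set_val (h a) = @ds_chart j x ;
  ds_dom_open : forall i, open (ds_dom i) ;
  ds_chart_homeo : forall i,
    homeo_onto_image (fun x : ds_dom i => @ds_chart i (set_val x)) }.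

Definition dsubset (M : omin_structure) (X : dspace M) (A : set X) : Prop :=
  forall i, mdefinable (@ds_chart M X i @` (A `&` ds_dom i)).

Section Definability.
Context (M : omin_structure).
Let L := olang M.
Let Itp := ointerp M.

Fixpoint tmap V W (r : V -> W) (t : term L V) : term L W :=
  match t with
  | Var x => Var L (r x)
  | App _ f ts => App f (fun i => tmap r (ts i))
  end.

Fixpoint fmap V W (r : V -> W) (phi : formula L V) {struct phi} : formula L W :=
  match phi with
  | Eq s t => Eq (tmap r s) (tmap r t)
  | Lt s t => Lt (tmap r s) (tmap r t)
  | Rel _ R ts => Rel R (fun i => tmap r (ts i))
  | Not psi => Not (fmap r psi)
  | And psi1 psi2 => And (fmap r psi1) (fmap r psi2)
  | Ex psi => Ex (fmap (omap r) psi)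
  end.

Lemma eval_tmap V W (r : V -> W) (v : W -> M) t :
  eval Itp v (tmap r t) = eval Itp (v \o r) t.
Proof.
elim: t => [x|n f ts IH] //=.
by congr (ifun Itp f _); apply/funext => i; exact: IH.
Qed.

Lemma sat_fmap V W (r : V -> W) (v : W -> M) (phi : formula L V) :
  sat Itp v (fmap r phi) = sat Itp (v \o r) phi.
Proof.
elim: phi W r v => {V} /=.
- by move=> V s t W r v; rewrite !eval_tmap.
- by move=> V s t W r v; rewrite !eval_tmap.
- move=> V n R ts W r v; congr (irel Itp R _); apply/funext => i; exact: eval_tmap.
- by move=> V psi IH W r v; rewrite IH.
- by move=> V psi1 IH1 psi2 IH2 W r v; rewrite IH1 IH2.
- move=> V psi IH W r v; congr (exists a, _); apply/funext => a.
  by rewrite IH; congr (sat Itp _ psi); apply/funext => -[].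
Qed.

Definition dpred (I : Type) (P : (I -> M) -> Prop) : Prop :=
  exists phi : formula L (I + M), forall x, P x <-> sat Itp (with_params x) phi.

Lemma dpred_ext I (P Q : (I -> M) -> Prop) :
  (forall x, P x <-> Q x) -> dpred P -> dpred Q.
Proof. by move=> PQ [phi h]; exists phi => x; rewrite -PQ. Qed.

Lemma dpred_reindex I J (P : (I -> M) -> Prop) (r : I -> J) :
  dpred P -> dpred (fun u => P (u \o r)).
Proof.
move=> [phi h].
exists (fmap (fun u => match u with inl i => inl (r i) | inr a => inr a end) phi).
move=> x; rewrite sat_fmap h.
by have -> : with_params (x \o r) = with_params x \o
  (fun u => match u with inl i => inl (r i) | inr a => inr a end)
  by apply/funext => -[].
Qed.

Lemma dpredN I (P : (I -> M) -> Prop) : dpred P -> dpred (fun x => ~ P x).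
Proof. by move=> [phi h]; exists (Not phi) => x /=; rewrite h. Qed.

Lemma dpredI I (P Q : (I -> M) -> Prop) :
  dpred P -> dpred Q -> dpred (fun x => P x /\ Q x).
Proof.
by move=> [phi h] [psi k]; exists (And phi psi) => x /=; rewrite h k.
Qed.

Lemma dpredU I (P Q : (I -> M) -> Prop) :
  dpred P -> dpred Q -> dpred (fun x => P x \/ Q x).
Proof.
move=> p q; apply: dpred_ext (dpredN (dpredI (dpredN p) (dpredN q))) => x.
split=> [/not_andP[/contrapT|/contrapT]|[hp|hq] [np nq]]; [by left|by right|exact: np|
  exact: nq].
Qed.

Lemma dpredT I : dpred (fun _ : I -> M => True).
Proof.
have [[i]|noI] := pselect (inhabited (I + M)).
  by exists (Eq (Var L i) (Var L i)).
exists (Not (Ex (Eq (Var L None) (Var L None)))) => x; split => // _ [a _].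
by apply: noI; exists; right.
Qed.

Lemma dpredF I : dpred (fun _ : I -> M => False).
Proof.
by apply: dpred_ext (dpredN (dpredT I)) => x; split => // /(_ Logic.I).
Qed.

Lemma dpred_ex I (P : (option I -> M) -> Prop) :
  dpred P -> dpred (fun x => exists a, P (ocons a x)).
Proof.
move=> [phi h].
pose r (u : option I + M) : option (I + M) :=
  match u with inl (Some i) => Some (inl i) | inl None => None
             | inr a => Some (inr a) end.
exists (Ex (fmap r phi)) => x /=.
have E a : P (ocons a x) <-> sat Itp (ocons a (with_params x)) (fmap r phi).
  rewrite sat_fmap h.
  by have -> : with_params (ocons a x) = ocons a (with_params x) \o r
    by apply/funext => -[[]|].
by split=> -[a Pa]; exists a; apply/E.
Qed.

Lemma dpred_exfin I (K : finType) (P : K -> (I -> M) -> Prop) :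
  (forall k, dpred (P k)) -> dpred (fun x => exists k, P k x).
Proof.
move=> dP; suff H (s : seq K) : dpred (fun x => exists2 k, k \in s & P k x).
  apply: dpred_ext (H (enum K)) => x; split => [[k _ h]|[k h]]; exists k => //.
  by rewrite mem_enum.
elim: s => [|k s IH]; first by apply: dpred_ext (dpredF I) => x; split=> // -[].
apply: dpred_ext (dpredU (dP k) IH) => x; split.
  case=> [h|[l ls h]]; first by exists k => //; rewrite mem_head.
  by exists l => //; rewrite inE ls orbT.
case=> l; rewrite inE => /orP[/eqP->|ls] h; first by left.
by right; exists l.
Qed.

Lemma dpred_exv n I (P : (I -> M) -> 'rV[M]_n -> Prop) :
  dpred (fun u : I + 'I_n -> M => P (u \o inl) (\row_k u (inr k))) ->
  dpred (fun x => exists b, P x b).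
Proof.
elim: n I P => [|n IH] I P.
  have no (k : 'I_0) : I by case: k.
  move=> dP; pose r (u : I + 'I_0) : I :=
    match u with inl i => i | inr k => no k end.
  apply: dpred_ext (dpred_reindex r dP) => x.
  split=> [h|[b]]; first by eexists; exact: h.
  by congr (P _ _); apply/rowP => -[].
move=> dP.
pose glue (a : M) (b : 'rV[M]_n) : 'rV[M]_n.+1 :=
  \row_k if unlift ord0 k is Some j then b ord0 j else a.
pose Q (u : option I -> M) (b : 'rV[M]_n) := P (u \o Some) (glue (u None) b).
have dQ : dpred (fun u => exists b, Q u b).
  apply: IH.
  pose r (u : I + 'I_n.+1) : option I + 'I_n := match u with
    | inl i => inl (Some i)
    | inr k => if unlift ord0 k is Some j then inr j else inl None end.
  apply: dpred_ext (dpred_reindex r dP) => u; rewrite /Q.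
  have -> // : \row_k (u \o r) (inr k) =
      glue ((u \o inl) None) (\row_k u (inr k)).
  by apply/rowP => k; rewrite !mxE /=; case: unliftP => //= j _; rewrite mxE.
apply: dpred_ext (dpred_ex dQ) => x; split=> [[a [b]]|[b Pb]].
  by rewrite /Q => h; exists (glue a b).
exists (b ord0 ord0), (\row_k b ord0 (lift ord0 k)); rewrite /Q /=.
have -> // : glue (b ord0 ord0) (\row_k b ord0 (lift ord0 k)) = b.
by apply/rowP => k; rewrite !mxE; case: unliftP => [j ->|->]; rewrite ?mxE.
Qed.

Definition coordsel I n (t : (I -> M) -> 'rV[M]_n) :=
  exists r : 'I_n -> I, forall u, t u = \row_k u (r k).

Lemma coordsel_row I n (r : 'I_n -> I) :
  coordsel (fun u : I -> M => \row_k u (r k)).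
Proof. by exists r. Qed.

Lemma coordsel_comp I J n (t : (I -> M) -> 'rV[M]_n) (s : I -> J) :
  coordsel t -> coordsel (fun u => t (u \o s)).
Proof. by case=> r h; exists (s \o r) => u; rewrite h. Qed.

Lemma coordsel_mx I m n (t : (I -> M) -> 'rV[M]_m) (s : (I -> M) -> 'rV[M]_n) :
  coordsel t -> coordsel s -> coordsel (fun u => row_mx (t u) (s u)).
Proof.
move=> [r h] [q k].
exists (fun i => match fintype.split i with inl j => r j | inr j => q j end) => u.
by apply/rowP => i; rewrite h k !mxE; case: fintype.split => j; rewrite mxE.
Qed.

Lemma coordsel_l I m n (t : (I -> M) -> 'rV[M]_(m + n)) :
  coordsel t -> coordsel (fun u => lsubmx (t u)).
Proof.
by move=> [r h]; exists (r \o lshift n) => u; apply/rowP => i; rewrite h !mxE.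
Qed.

Lemma coordsel_r I m n (t : (I -> M) -> 'rV[M]_(m + n)) :
  coordsel t -> coordsel (fun u => rsubmx (t u)).
Proof.
by move=> [r h]; exists (r \o @rshift m n) => u; apply/rowP => i; rewrite h !mxE.
Qed.

Lemma dpred_in I n (A : set 'rV[M]_n) (t : (I -> M) -> 'rV[M]_n) :
  mdefinable A -> coordsel t -> dpred (fun u => A (t u)).
Proof.
move=> [phi h] [r tr].
have dA : dpred (fun u : 'I_n -> M => A (\row_k u k)).
  exists phi => u; rewrite h.
  have -> // : (\row_k u k) ord0 = u by apply/funext => k; rewrite mxE.
apply: dpred_ext (dpred_reindex r dA) => u.
by rewrite tr.
Qed.

Lemma mdefinableP n (A : set 'rV[M]_n) :
  dpred (fun u : 'I_n -> M => A (\row_k u k)) -> mdefinable A.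
Proof.
move=> [phi h]; exists phi => x; rewrite -h.
by have -> : \row_k x ord0 k = x by apply/rowP => k; rewrite mxE.
Qed.

End Definability.

Section Topology.

Lemma continuous_nbhsP (S T : topologicalType) (f : S -> T) :
  continuous f <-> forall x V, nbhs (f x) V -> nbhs x (f @^-1` V).
Proof. by []. Qed.

Lemma nbhs_set_type (T : topologicalType) (A : set T) (a : A) (U : set A) :
  nbhs a U <-> exists2 V, nbhs (set_val a) V & set_val @^-1` V `<=` U.
Proof.
split=> [|[V aV VU]].
  move=> [_ [[V oV <-] Va] VU].
  by exists V => //; exact: open_nbhs_nbhs.
apply: filterS VU _; exact: (@initial_continuous A T set_val).
Qed.

Lemma homeomorphism_sym (S T : topologicalType) (h : S -> T) :
  homeomorphism h ->
  exists g : T -> S, [/\ homeomorphism g, cancel h g & cancel g h].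
Proof. by move=> [ch [g [cg hg gh]]]; exists g; split=> //; split=> //; exists h. Qed.

Lemma homeomorphism_comp (S T U : topologicalType) (h : S -> T) (k : T -> U) :
  homeomorphism h -> homeomorphism k -> homeomorphism (k \o h).
Proof.
move=> [ch [h' [ch' hh' h'h]]] [ck [k' [ck' kk' k'k]]]; split.
  by move=> x; apply: continuous_comp; [exact: ch|exact: ck].
exists (h' \o k'); split; last 2 first.
- exact: can_comp.
- exact: can_comp.
by move=> x; apply: continuous_comp; [exact: ck'|exact: ch'].
Qed.

Lemma homeo_between_images (S T1 T2 : topologicalType) (f1 : S -> T1)
    (f2 : S -> T2) (A1 : set T1) (A2 : set T2) :
  range f1 = A1 -> range f2 = A2 ->
  homeo_onto_image f1 -> homeo_onto_image f2 ->
  exists h : A1 -> A2, homeomorphism h /\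
    forall a x, f1 x = set_val a -> set_val (h a) = f2 x.
Proof.
move=> <- <- /homeomorphism_sym[g [hg f1g gf1]] hf2.
exists (corestrict f2 \o g); split; first exact: homeomorphism_comp.
move=> a x e; have -> : a = corestrict f1 x by apply/val_inj/esym.
by rewrite /= f1g.
Qed.

Lemma homeo_onto_imageP (S T : topologicalType) (f : S -> T) :
  homeo_onto_image f <->
  [/\ injective f, continuous f &
      forall x U, nbhs x U -> exists2 V, nbhs (f x) V & f @^-1` V `<=` U].
Proof.
split=> [[cf [g [cg fg gf]]]|[fI cf of_]].
  split.
  - move=> x y e; have h : corestrict f x = corestrict f y by exact: val_inj.
    by rewrite -[x]fg h fg.
  - move=> x V fxV; apply: (cf x (set_val @^-1` V)).
    by apply/nbhs_set_type; exists V.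
  - move=> x U xU; have : nbhs (corestrict f x) (g @^-1` U).
      by apply: (cg (corestrict f x) U); rewrite fg.
    move=> /nbhs_set_type[V fxV VU]; exists V => // y Vy.
    by have := VU (corestrict f y) Vy; rewrite /preimage /= fg.
split.
  apply/continuous_nbhsP => x U /nbhs_set_type[V fxV VU].
  have /continuous_nbhsP/(_ _ _ fxV) := cf; apply: filterS => y Vy; exact: VU.
have pre (a : range f) : exists x, f x = set_val a.
  by case: (set_valP a) => x _ e; exists x.
pose g a := projT1 (cid (pre a)).
have gP a : f (g a) = set_val a by rewrite /g; case: cid.
have gK : cancel g (corestrict f) by move=> a; exact/val_inj/gP.
have fK : cancel (corestrict f) g by move=> x; apply: fI; rewrite gP.
exists g; split => //; apply/continuous_nbhsP => a U /of_ [V gaV VU].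
apply/nbhs_set_type; exists V; first by rewrite -gP.
by move=> b /= Vb; apply: VU; rewrite /preimage /= gP.
Qed.

Definition emb_on (S T : topologicalType) (A : set S) (f : S -> T) :=
  [/\ {in A &, injective f},
      forall x V, A x -> nbhs (f x) V ->
        exists2 U, nbhs x U & A `&` U `<=` f @^-1` V &
      forall x U, A x -> nbhs x U ->
        exists2 V, nbhs (f x) V & A `&` f @^-1` V `<=` U].

Lemma emb_onP (S T : topologicalType) (A : set S) (f : S -> T) :
  homeo_onto_image (fun x : A => f (set_val x)) <-> emb_on A f.
Proof.
rewrite homeo_onto_imageP; split=> -[fI cf of_]; split.
- move=> x y xA yA e.
  by have /(congr1 set_val) := fI (SigSub xA) (SigSub yA) e.
- move=> x V /mem_set xA fxV.
  have /nbhs_set_type[U xU UV] := cf (SigSub xA) V fxV.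
  by exists U => // y [/mem_set yA Uy]; exact: (UV (SigSub yA)).
- move=> x U /mem_set xA xU.
  have [|V fxV VU] := of_ (SigSub xA) (set_val @^-1` U).
    by apply/nbhs_set_type; exists U.
  by exists V => // y [/mem_set yA Vy]; exact: (VU (SigSub yA)).
- by move=> x y e; apply/val_inj/fI => //; exact/valP.
- apply/continuous_nbhsP => x V fxV.
  have [U xU UV] := cf _ _ (set_valP x) fxV.
  apply/nbhs_set_type; exists U => // y Uy.
  by apply: UV; split => //; exact: set_valP.
- move=> x U /nbhs_set_type[W xW WU].
  have [V fxV VW] := of_ _ _ (set_valP x) xW.
  exists V => // y Vy; apply/WU/VW; split => //; exact: set_valP.
Qed.

Lemma emb_on_sub (S T : topologicalType) (A B : set S) (f : S -> T) :
  B `<=` A -> emb_on A f -> emb_on B f.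
Proof.
move=> BA [fI cf of_]; split.
- by move=> x y /set_mem/BA/mem_set xA /set_mem/BA/mem_set yA; exact: fI.
- move=> x V /BA Ax /(cf _ _ Ax)[U xU UV]; exists U => // y [/BA Ay Uy].
  exact: UV.
- move=> x U /BA Ax /(of_ _ _ Ax)[V xV VU]; exists V => // y [/BA Ay Vy].
  exact: VU.
Qed.

Lemma emb_on_open (S T : topologicalType) (A W : set S) (f : S -> T) :
  emb_on A f -> W `<=` A -> open W ->
  exists2 U : set T, open U & f @` W = U `&` f @` A.
Proof.
move=> [fI cf of_] WA oW; exists (interior (~` (f @` (A `\` W)))).
  exact: open_interior.
rewrite eqEsubset; split=> [_ [x Wx <-]|b [/interior_subset nW [x Ax xb]]].
  split; last by exists x => //; exact: WA.
  have [V fxV VW] := of_ x W (WA _ Wx) (open_nbhs_nbhs (conj oW Wx)).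
  apply: filterS fxV => b Vb [y [Ay nWy] yb]; apply: nWy; apply: VW.
  by split => //; rewrite /preimage /= yb.
by exists x => //; apply: contrapT => nWx; apply: nW; exists x.
Qed.

Lemma nbhs_row_mx (T : topologicalType) m n (a : 'rV[T]_m) (b : 'rV[T]_n)
    (W : set 'rV[T]_(m + n)) :
  nbhs (row_mx a b) W <->
  exists2 UV : set 'rV[T]_m * set 'rV[T]_n,
    nbhs a UV.1 /\ nbhs b UV.2 &
    forall a' b', UV.1 a' -> UV.2 b' -> W (row_mx a' b').
Proof.
split=> [[P hP PW]|[[U V] /= [[P hP PU] [Q hQ QV]] UVW]].
  exists ([set a' : 'rV_m | forall i j, P i (lshift n j) (a' i j)],
          [set b' : 'rV_n | forall i j, P i (rshift m j) (b' i j)]) => /=.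
    split.
      exists (fun i j => P i (lshift n j)) => // i j.
      by have := hP i (lshift n j); rewrite row_mxEl.
    exists (fun i j => P i (rshift m j)) => // i j.
    by have := hP i (rshift m j); rewrite row_mxEr.
  move=> a' b' Pa Pb; apply: PW => i j.
  by case: (split_ordP j) => k ->; rewrite ?row_mxEl ?row_mxEr.
exists (fun i j => match fintype.split j with
                   | inl k => P i k | inr k => Q i k end).
  by move=> i j; rewrite mxE; case: fintype.split.
move=> w hw; rewrite -[w]hsubmxK; apply: UVW.
  apply: PU => i j; rewrite mxE; have := hw i (lshift n j).
  by rewrite (unsplitK (inl j : 'I_m + 'I_n)).
apply: QV => i j; rewrite mxE; have := hw i (rshift m j).
by rewrite (unsplitK (inr j : 'I_m + 'I_n)).
Qed.

Lemma emb_on_row_mx (S S' T : topologicalType) m n (A : set S) (B : set S')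
    (f : S -> 'rV[T]_m) (g : S' -> 'rV[T]_n) :
  emb_on A f -> emb_on B g ->
  emb_on (A `*` B) (fun p : S * S' => row_mx (f p.1) (g p.2)).
Proof.
move=> [fI cf of_] [gI cg og]; split.
- move=> [x y] [x' y'] /set_mem[/= Ax By] /set_mem[/= Ax' By'] /eq_row_mx[e e'].
  by congr pair; [apply: fI|apply: gI] => //; exact: mem_set.
- move=> [x y] W [/= Ax By] /nbhs_row_mx[[U V] /= [xU yV] UVW].
  have [U' xU' U'U] := cf _ _ Ax xU; have [V' yV' V'V] := cg _ _ By yV.
  exists (U' `*` V'); first by exists (U', V').
  move=> [x' y'] [[/= Ax' By'] [/= U'x' V'y']]; apply: UVW => /=.
    exact: U'U.
  exact: V'V.
- move=> [x y] W [/= Ax By] [[U V] /= [xU yV] UVW].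
  have [U' xU' U'U] := of_ _ _ Ax xU; have [V' yV' V'V] := og _ _ By yV.
  exists [set w | U' (lsubmx w) /\ V' (rsubmx w)].
    apply/nbhs_row_mx; exists (U', V') => //= a' b' U'a' V'b'.
    by rewrite row_mxKl row_mxKr.
  move=> [x' y'] [[/= Ax' By'] /=]; rewrite row_mxKl row_mxKr => -[U'x' V'y'].
  by apply: UVW; split => /=; [exact: U'U|exact: V'V].
Qed.

Lemma emb_on_val (S T : topologicalType) (A B : set S) (f : S -> T) :
  emb_on B f -> emb_on (set_val @^-1` B : set A) (fun x : A => f (set_val x)).
Proof.
move=> [fI cf of_]; split.
- move=> x y /set_mem Bx /set_mem By e; apply/val_inj/fI => //; exact: mem_set.
- move=> x V Bx fxV; have [U xU UV] := cf _ _ Bx fxV.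
  exists (set_val @^-1` U); first by apply/nbhs_set_type; exists U.
  by move=> y [By Uy]; exact: UV.
- move=> x U Bx /nbhs_set_type[W xW WU].
  have [V fxV VW] := of_ _ _ Bx xW; exists V => // y [By Vy].
  by apply/WU/VW.
Qed.

End Topology.

Section Atlas.
Context (M : omin_structure) (X : topologicalType) (K : finType).
Variables (dim : K -> nat) (dom : K -> set X).
Variable (chart : forall i, X -> 'rV[M]_(dim i)).
Hypothesis cover : \bigcup_i dom i = setT.
Hypothesis dom_open : forall i, open (dom i).
Hypothesis chart_emb : forall i, emb_on (dom i) (@chart i).
Hypothesis chart_def : forall i, mdefinable (@chart i @` dom i).
Hypothesis overlap_def : forall i j, mdefinable (@chart i @` (dom i `&` dom j)).
Hypothesis transition_def : forall i j,
  mdefinable ((fun x => row_mx (@chart i x) (@chart j x))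
                @` (dom i `&` dom j)).

Lemma range_set_val T (A : set X) (f : X -> T) :
  range (fun x : A => f (set_val x)) = f @` A.
Proof.
rewrite eqEsubset; split=> [_ [x _ <-]|_ [x Ax <-]].
  by exists (set_val x) => //; exact: set_valP.
by exists (SigSub (mem_set Ax)).
Qed.

Lemma atlas_inj i : {in dom i &, injective (@chart i)}.
Proof. by have [] := chart_emb i. Qed.

Lemma atlas_overlap_open i j : exists2 U : set 'rV[M]_(dim i), open U &
  @chart i @` (dom i `&` dom j) = U `&` @chart i @` dom i.
Proof. by apply: (emb_on_open (chart_emb i)) => //; exact: openI. Qed.

Lemma atlas_transition_homeo i j :
  exists h : (@chart i @` (dom i `&` dom j)) ->
             (@chart j @` (dom i `&` dom j)),
    homeomorphism h /\
    forall a x, (dom i `&` dom j) x ->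
      @chart i x = set_val a -> set_val (h a) = @chart j x.
Proof.
set D := dom i `&` dom j.
have hi : emb_on D (@chart i) by apply: emb_on_sub (chart_emb i) => x [].
have hj : emb_on D (@chart j) by apply: emb_on_sub (chart_emb j) => x [].
have [h [hh hE]] := homeo_between_images (range_set_val D (@chart i))
  (range_set_val D (@chart j)) (iffRL (emb_onP _ _) hi) (iffRL (emb_onP _ _) hj).
exists h; split => // a x Dx e.
exact: (hE a (SigSub (mem_set Dx))).
Qed.

Lemma atlas_homeo i : homeo_onto_image (fun x : dom i => @chart i (set_val x)).
Proof. exact/emb_onP. Qed.

Definition dspace_of_atlas : dspace M :=
  DSpace cover atlas_inj chart_def overlap_def atlas_overlap_open
    transition_def atlas_transition_homeo dom_open atlas_homeo.

End Atlas.
Ltac coordsel_tac := first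
  [ by eexists => ?; apply/rowP => ?; rewrite !mxE /=; reflexivity
  | apply: coordsel_mx; coordsel_tac
  | apply: coordsel_l; coordsel_tac
  | apply: coordsel_r; coordsel_tac ].

Lemma mdefinable_by (M : omin_structure) n (A : set 'rV[M]_n)
    (P : 'rV[M]_n -> Prop) :
  (forall w, P w <-> A w) -> dpred (fun u => P (\row_k u k)) -> mdefinable A.
Proof.
move=> PA dP; apply: mdefinableP; apply: dpred_ext dP => u; exact: PA.
Qed.

Section Constructions.
Context (M : omin_structure).
Implicit Types X Y Z : dspace M.

Lemma chart_emb X (i : ds_index X) :
  emb_on (ds_dom i) (ds_chart i).
Proof. exact/emb_onP/ds_chart_homeo. Qed.

Lemma chart_inj X (i : ds_index X) (x y : X) :
  ds_dom i x -> ds_dom i y -> ds_chart i x = ds_chart i y -> x = y.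
Proof.
by move=> /mem_set ix /mem_set iy; exact: (ds_chart_inj ix iy).
Qed.

Lemma in_some_chart X (x : X) : exists i : ds_index X, ds_dom i x.
Proof. by have : setT x by []; rewrite -(ds_cover X) => -[i _]; exists i. Qed.

Section Sub.
Variables (X : dspace M) (A : set X).
Hypothesis dA : dsubset A.

Let dom (i : ds_index X) : set A := set_val @^-1` ds_dom i.
Let chart (i : ds_index X) (x : A) := ds_chart i (set_val x).

Lemma sub_cover : \bigcup_i dom i = setT.
Proof.
rewrite -subTset => x _; have [i ix] := in_some_chart (set_val x).
by exists i.
Qed.

Lemma sub_dom_open i : open (dom i).
Proof. by exists (ds_dom i) => //; exact: ds_dom_open. Qed.

Lemma sub_chart_emb i : emb_on (dom i) (@chart i).
Proof. exact/emb_on_val/chart_emb. Qed.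

Lemma sub_image T (f : X -> T) (D : set X) :
  (fun x : A => f (set_val x)) @` (set_val @^-1` D) = f @` (A `&` D).
Proof.
rewrite eqEsubset; split=> [_ [x Dx <-]|_ [x [Ax Dx] <-]].
  by exists (set_val x) => //; split => //; exact: set_valP.
by exists (SigSub (mem_set Ax)).
Qed.

Lemma sub_chart_def i : mdefinable (@chart i @` dom i).
Proof. by rewrite sub_image. Qed.

Lemma sub_overlap_def i j : mdefinable (@chart i @` (dom i `&` dom j)).
Proof.
rewrite /dom -preimage_setI sub_image.
apply: (@mdefinable_by _ _ _ (fun w => (ds_chart i @` (A `&` ds_dom i)) w /\
  (ds_chart i @` (ds_dom i `&` ds_dom j)) w)).
  move=> w; split=> [[[x [Ax ix] <-] [y [iy jy]]]|[x [Ax [ix jx]] <-]].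
    by move=> /(chart_inj iy ix) e; exists x => //; rewrite -e in Ax ix *.
  by split; exists x.
apply: dpredI.
  by apply: (dpred_in (dA i)); coordsel_tac.
by apply: (dpred_in (ds_overlap_def i j)); coordsel_tac.
Qed.

Lemma sub_transition_def i j :
  mdefinable ((fun x => row_mx (@chart i x) (@chart j x)) @` (dom i `&` dom j)).
Proof.
rewrite /dom -preimage_setI.
rewrite (sub_image (fun x => row_mx (ds_chart i x) (ds_chart j x))).
apply: (@mdefinable_by _ _ _ (fun w =>
  (ds_chart i @` (A `&` ds_dom i)) (lsubmx w) /\
  ((fun x => row_mx (ds_chart i x) (ds_chart j x))
    @` (ds_dom i `&` ds_dom j)) w)).
  move=> w; split=> [[[x [Ax ix] e] [y [iy jy] yw]]|[x [Ax [ix jx]] <-]].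
    move: e; rewrite -yw row_mxKl => /(chart_inj ix iy) xy.
    by exists y => //; rewrite -xy in jy *.
  by rewrite row_mxKl; split; exists x.
apply: dpredI.
  by apply: (dpred_in (dA i)); coordsel_tac.
by apply: (dpred_in (ds_transition_def i j)); coordsel_tac.
Qed.

Definition sub_dspace : dspace M :=
  dspace_of_atlas sub_cover sub_dom_open sub_chart_emb sub_chart_def
    sub_overlap_def sub_transition_def.

End Sub.

Section Prod.
Variables X Y : dspace M.

Let dom (k : ds_index X * ds_index Y) : set (X * Y) :=
  ds_dom k.1 `*` ds_dom k.2.
Let chart (k : ds_index X * ds_index Y) (p : X * Y) :=
  row_mx (ds_chart k.1 p.1) (ds_chart k.2 p.2).

Lemma prod_cover : \bigcup_k dom k = setT.
Proof.
rewrite -subTset => -[x y] _; have [i ix] := in_some_chart x.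
by have [j jy] := in_some_chart y; exists (i, j).
Qed.

Lemma prod_dom_open k : open (dom k).
Proof.
case: k => i j; rewrite openE => -[x y] [/= ix jy].
exists (ds_dom i, ds_dom j) => //; split; apply: open_nbhs_nbhs; split => //;
  exact: ds_dom_open.
Qed.

Lemma prod_chart_emb k : emb_on (dom k) (@chart k).
Proof. apply: emb_on_row_mx; exact: chart_emb. Qed.

Lemma prod_chart_def k : mdefinable (@chart k @` dom k).
Proof.
case: k => i j; apply: (@mdefinable_by _ _ _ (fun w =>
  (ds_chart i @` ds_dom i) (lsubmx w) /\ (ds_chart j @` ds_dom j) (rsubmx w))).
  move=> w; split=> [[[x ix xw] [y jy yw]]|[[x y] [/= ix jy] <-]].
    by exists (x, y) => //; rewrite /chart /= xw yw hsubmxK.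
  by rewrite row_mxKl row_mxKr; split; [exists x|exists y].
apply: dpredI.
  by apply: (dpred_in (ds_chart_def i)); coordsel_tac.
by apply: (dpred_in (ds_chart_def j)); coordsel_tac.
Qed.

Lemma prod_overlap_def k l : mdefinable (@chart k @` (dom k `&` dom l)).
Proof.
case: k l => i j [i' j']; apply: (@mdefinable_by _ _ _ (fun w =>
  (ds_chart i @` (ds_dom i `&` ds_dom i')) (lsubmx w) /\
  (ds_chart j @` (ds_dom j `&` ds_dom j')) (rsubmx w))).
  move=> w; split.
    move=> [[x [ix ix'] xw] [y [jy jy'] yw]].
    by exists (x, y) => //; rewrite /chart /= xw yw hsubmxK.
  move=> [[x y] [[/= ix jy] [/= ix' jy']] <-].
  by rewrite row_mxKl row_mxKr; split; [exists x|exists y].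
apply: dpredI.
  by apply: (dpred_in (ds_overlap_def i i')); coordsel_tac.
by apply: (dpred_in (ds_overlap_def j j')); coordsel_tac.
Qed.

Lemma prod_transition_def k l :
  mdefinable ((fun x => row_mx (@chart k x) (@chart l x)) @` (dom k `&` dom l)).
Proof.
case: k l => i j [i' j']; apply: (@mdefinable_by _ _ _ (fun w =>
  ((fun x => row_mx (ds_chart i x) (ds_chart i' x))
     @` (ds_dom i `&` ds_dom i'))
    (row_mx (lsubmx (lsubmx w)) (lsubmx (rsubmx w))) /\
  ((fun y => row_mx (ds_chart j y) (ds_chart j' y))
     @` (ds_dom j `&` ds_dom j'))
    (row_mx (rsubmx (lsubmx w)) (rsubmx (rsubmx w))))).
  move=> w; split.
    move=> [[x [ix ix'] /eq_row_mx[xw xw']] [y [jy jy'] /eq_row_mx[yw yw']]].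
    by exists (x, y) => //; rewrite /chart /= xw xw' yw yw' !hsubmxK.
  move=> [[x y] [[/= ix jy] [/= ix' jy']] <-].
  by rewrite /chart /= !row_mxKl !row_mxKr !row_mxKl; split; [exists x|exists y].
apply: dpredI.
  by apply: (dpred_in (ds_transition_def i i')); coordsel_tac.
by apply: (dpred_in (ds_transition_def j j')); coordsel_tac.
Qed.

Definition prod_dspace : dspace M :=
  dspace_of_atlas prod_cover prod_dom_open prod_chart_emb prod_chart_def
    prod_overlap_def prod_transition_def.

End Prod.

(* Each composite chart map is definable, i.e. its graph is; its natural domain
   is then definable as a projection of the graph. *)
Definition definable_map X Y (f : X -> Y) : Prop :=
  forall (i : ds_index X) (j : ds_index Y),
    mdefinable ((fun x => row_mx (ds_chart i x) (ds_chart j (f x)))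
                  @` (ds_dom i `&` f @^-1` ds_dom j)).

Record morphism X Y := Morphism {
  mfun :> X -> Y ;
  mfun_continuous : continuous mfun ;
  mfun_definable : definable_map mfun }.


Arguments mfun_continuous {X Y} m.
Arguments mfun_definable {X Y} m.

Lemma id_definable X : definable_map (@id X).
Proof. by move=> i j; exact: ds_transition_def. Qed.

Definition id_morphism X : morphism X X :=
  Morphism (fun x => @cvg_id _ _) (@id_definable X).

Lemma comp_continuous X Y Z (f : morphism X Y) (g : morphism Y Z) :
  continuous (g \o f).
Proof.
by move=> x; apply: continuous_comp; exact: mfun_continuous.
Qed.

Lemma comp_definable X Y Z (f : morphism X Y) (g : morphism Y Z) :
  definable_map (g \o f).
Proof.
move=> i l.
apply: (@mdefinable_by _ _ _ (fun w => exists j : ds_index Y, exists b,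
  ((fun x => row_mx (ds_chart i x) (ds_chart j (f x)))
     @` (ds_dom i `&` f @^-1` ds_dom j)) (row_mx (lsubmx w) b) /\
  ((fun y => row_mx (ds_chart j y) (ds_chart l (g y)))
     @` (ds_dom j `&` g @^-1` ds_dom l)) (row_mx b (rsubmx w)))).
  move=> w; split.
    move=> [j [b [[x [ix jfx] /eq_row_mx[xw fxb]] [y [jy lgy]]]]].
    move=> /eq_row_mx[yb gyw]; have e : f x = y.
      by apply: (chart_inj jfx jy); rewrite fxb yb.
    exists x; first by split => //; rewrite /preimage /= e.
    by rewrite /= e xw gyw hsubmxK.
  move=> [x [ix lgfx] <-]; have [j jfx] := in_some_chart (f x).
  exists j, (ds_chart j (f x)); rewrite row_mxKl row_mxKr.
  by split; [exists x|exists (f x)].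
apply: dpred_exfin => j; apply: dpred_exv; apply: dpredI.
  by apply: (dpred_in (mfun_definable f i j)); coordsel_tac.
by apply: (dpred_in (mfun_definable g j l)); coordsel_tac.
Qed.

Definition comp_morphism X Y Z (g : morphism Y Z) (f : morphism X Y) :
  morphism X Z := Morphism (@comp_continuous X Y Z f g) (comp_definable f g).

Lemma fst_definable X Y : @definable_map (prod_dspace X Y) X fst.
Proof.
move=> [i j] i'; apply: (@mdefinable_by _ _ _ (fun w =>
  ((fun x => row_mx (ds_chart i x) (ds_chart i' x))
     @` (ds_dom i `&` ds_dom i'))
    (row_mx (lsubmx (lsubmx w)) (rsubmx w)) /\
  (ds_chart j @` ds_dom j) (rsubmx (lsubmx w)))).
  move=> w; split.
    move=> [[x [ix ix'] /eq_row_mx[xw xw']] [y jy yw]].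
    by exists (x, y) => //=; rewrite xw xw' yw !hsubmxK.
  move=> [[x y] [[/= ix jy] /= ix'] <-].
  by rewrite !row_mxKl !row_mxKr; split; [exists x|exists y].
apply: dpredI.
  by apply: (dpred_in (ds_transition_def i i')); coordsel_tac.
by apply: (dpred_in (ds_chart_def j)); coordsel_tac.
Qed.

Lemma snd_definable X Y : @definable_map (prod_dspace X Y) Y snd.
Proof.
move=> [i j] j'; apply: (@mdefinable_by _ _ _ (fun w =>
  ((fun x => row_mx (ds_chart j x) (ds_chart j' x))
     @` (ds_dom j `&` ds_dom j'))
    (row_mx (rsubmx (lsubmx w)) (rsubmx w)) /\
  (ds_chart i @` ds_dom i) (lsubmx (lsubmx w)))).
  move=> w; split.
    move=> [[y [jy jy'] /eq_row_mx[yw yw']] [x ix xw]].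
    by exists (x, y) => //=; rewrite xw yw yw' !hsubmxK.
  move=> [[x y] [[/= ix jy] /= jy'] <-].
  by rewrite !row_mxKl !row_mxKr; split; [exists y|exists x].
apply: dpredI.
  by apply: (dpred_in (ds_transition_def j j')); coordsel_tac.
by apply: (dpred_in (ds_chart_def i)); coordsel_tac.
Qed.

Lemma fst_continuous X Y : continuous (fst : X * Y -> X).
Proof. by move=> p; exact: cvg_fst. Qed.

Lemma snd_continuous X Y : continuous (snd : X * Y -> Y).
Proof. by move=> p; exact: cvg_snd. Qed.

Definition fst_morphism X Y : morphism (prod_dspace X Y) X :=
  @Morphism (prod_dspace X Y) X fst (@fst_continuous X Y) (@fst_definable X Y).

Definition snd_morphism X Y : morphism (prod_dspace X Y) Y :=
  @Morphism (prod_dspace X Y) Y snd (@snd_continuous X Y) (@snd_definable X Y).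

Lemma pair_definable W X Y (u : morphism W X) (v : morphism W Y) :
  @definable_map W (prod_dspace X Y) (fun w => (u w, v w)).
Proof.
move=> k [i j]; apply: (@mdefinable_by _ _ _ (fun w =>
  ((fun x => row_mx (ds_chart k x) (ds_chart i (u x)))
     @` (ds_dom k `&` u @^-1` ds_dom i))
    (row_mx (lsubmx w) (lsubmx (rsubmx w))) /\
  ((fun x => row_mx (ds_chart k x) (ds_chart j (v x)))
     @` (ds_dom k `&` v @^-1` ds_dom j))
    (row_mx (lsubmx w) (rsubmx (rsubmx w))))).
  move=> w; split.
    move=> [[x [kx iux] /eq_row_mx[xw uxw]] [y [ky jvy] /eq_row_mx[yw vyw]]].
    have e : x = y by apply: (chart_inj kx ky); rewrite xw yw.
    exists x; first by split => //; split => //=; rewrite e.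
    by rewrite /= xw uxw e vyw !hsubmxK.
  move=> [x [kx [/= iux jvx]] <-].
  by rewrite !row_mxKl !row_mxKr row_mxKl; split; exists x.
apply: dpredI.
  by apply: (dpred_in (mfun_definable u k i)); coordsel_tac.
by apply: (dpred_in (mfun_definable v k j)); coordsel_tac.
Qed.

Lemma pair_continuous W X Y (u : morphism W X) (v : morphism W Y) :
  continuous (fun w => (u w, v w)).
Proof. by move=> w; apply: cvg_pair; exact: mfun_continuous. Qed.

Definition pair_morphism W X Y (u : morphism W X) (v : morphism W Y) :
  morphism W (prod_dspace X Y) :=
  @Morphism W (prod_dspace X Y) _ (@pair_continuous W X Y u v) (pair_definable u v).

Lemma incl_continuous X (A : set X) : continuous (set_val : A -> X).
Proof. exact: initial_continuous. Qed.

Lemma incl_definable X (A : set X) (dA : dsubset A) :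
  @definable_map (sub_dspace dA) X set_val.
Proof. by move=> i j; exact: (sub_transition_def dA). Qed.

Definition incl_morphism X (A : set X) (dA : dsubset A) :
  morphism (sub_dspace dA) X :=
  @Morphism (sub_dspace dA) X set_val (@incl_continuous X A)
    (@incl_definable X A dA).

Definition lift_fun W X (A : set X) (f : morphism W X) (fA : forall w, A (f w))
  (w : W) : A := SigSub (mem_set (fA w)).

Lemma lift_continuous W X (A : set X) (f : morphism W X)
  (fA : forall w, A (f w)) : continuous (lift_fun fA).
Proof.
apply/continuous_nbhsP => w V /nbhs_set_type[U fwU UV].
have /continuous_nbhsP/(_ _ _ fwU) := mfun_continuous f.
by apply: filterS => z Uz; exact: UV.
Qed.

Definition lift_morphism W X (A : set X) (dA : dsubset A) (f : morphism W X)
    (fA : forall w, A (f w)) : morphism W (sub_dspace dA) :=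
  @Morphism W (sub_dspace dA) (lift_fun fA) (@lift_continuous W X A f fA)
    (mfun_definable f).

Lemma dsubset_preimage X Y (f : morphism X Y) (V : set Y) :
  dsubset V -> dsubset (f @^-1` V).
Proof.
move=> dV i; apply: (@mdefinable_by _ _ _ (fun w => exists j : ds_index Y,
  exists b, (ds_chart j @` (V `&` ds_dom j)) b /\
  ((fun x => row_mx (ds_chart i x) (ds_chart j (f x)))
     @` (ds_dom i `&` f @^-1` ds_dom j)) (row_mx w b))).
  move=> w; split.
    move=> [j [b [[y [Vy jy] yb] [x [ix jfx] /eq_row_mx[xw fxb]]]]].
    exists x => //; split => //; rewrite /preimage /=.
    by have -> : f x = y by apply: (chart_inj jfx jy); rewrite fxb yb.
  move=> [x [Vfx ix] <-]; have [j jfx] := in_some_chart (f x).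
  by exists j, (ds_chart j (f x)); split; [exists (f x)|exists x].
apply: dpred_exfin => j; apply: dpred_exv; apply: dpredI.
  by apply: (dpred_in (dV j)); coordsel_tac.
by apply: (dpred_in (mfun_definable f i j)); coordsel_tac.
Qed.

(* The type is given by [prod_dspace] so that the subset is seen in the
   definable space X * Y, whose topology is the product topology. *)
Definition fiber_set X Y Z (f : morphism X Z) (g : morphism Y Z) :
  set (prod_dspace X Y) := [set p : X * Y | f p.1 = g p.2].

Lemma fiber_dsubset X Y Z (f : morphism X Z) (g : morphism Y Z) :
  dsubset (fiber_set f g).
Proof.
move=> [i j]; apply: (@mdefinable_by _ _ _ (fun w => exists l : ds_index Z,
  exists c,
  ((fun x => row_mx (ds_chart i x) (ds_chart l (f x)))
     @` (ds_dom i `&` f @^-1` ds_dom l)) (row_mx (lsubmx w) c) /\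
  ((fun y => row_mx (ds_chart j y) (ds_chart l (g y)))
     @` (ds_dom j `&` g @^-1` ds_dom l)) (row_mx (rsubmx w) c))).
  move=> w; split.
    move=> [l [c [[x [ix lfx] /eq_row_mx[xw fxc]]]]].
    move=> [y [jy lgy] /eq_row_mx[yw gyc]].
    exists (x, y); last by rewrite /= xw yw hsubmxK.
    by split => //; apply: (chart_inj lfx lgy); rewrite fxc gyc.
  move=> [[x y] [/= e [/= ix jy]] <-]; have [l lfx] := in_some_chart (f x).
  exists l, (ds_chart l (f x)); rewrite row_mxKl row_mxKr; split.
    by exists x.
  by rewrite e in lfx *; exists y.
apply: dpred_exfin => l; apply: dpred_exv; apply: dpredI.
  by apply: (dpred_in (mfun_definable f i l)); coordsel_tac.
by apply: (dpred_in (mfun_definable g j l)); coordsel_tac.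
Qed.

Definition fiber X Y Z (f : morphism X Z) (g : morphism Y Z) : dspace M :=
  sub_dspace (fiber_dsubset f g).

Definition fiber_pr1 X Y Z (f : morphism X Z) (g : morphism Y Z) :
  morphism (fiber f g) X :=
  comp_morphism (fst_morphism X Y) (incl_morphism (fiber_dsubset f g)).

Definition fiber_pr2 X Y Z (f : morphism X Z) (g : morphism Y Z) :
  morphism (fiber f g) Y :=
  comp_morphism (snd_morphism X Y) (incl_morphism (fiber_dsubset f g)).

Lemma fiber_square X Y Z (f : morphism X Z) (g : morphism Y Z)
  (w : fiber f g) : f (fiber_pr1 f g w) = g (fiber_pr2 f g w).
Proof. exact: (set_valP w). Qed.

Definition fiber_pair W X Y Z (f : morphism X Z) (g : morphism Y Z)
    (u : morphism W X) (v : morphism W Y) (e : forall w, f (u w) = g (v w)) :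
  morphism W (fiber f g) :=
  lift_morphism (f := pair_morphism u v) (fiber_dsubset f g) e.

Definition diag_morphism X Y (f : morphism X Y) : morphism X (fiber f f) :=
  fiber_pair (f := f) (g := f) (u := id_morphism X) (v := id_morphism X)
    (fun=> erefl).

Lemma fiber_map_subproof X Y X' Y' Z
    (p : morphism X Z) (q : morphism Y Z) (f : morphism X Y)
    (p' : morphism X' Z) (q' : morphism Y' Z) (f' : morphism X' Y')
    (qf : forall x, q (f x) = p x) (qf' : forall x, q' (f' x) = p' x)
    (w : fiber p p') :
  q (comp_morphism f (fiber_pr1 p p') w) =
  q' (comp_morphism f' (fiber_pr2 p p') w).
Proof. by rewrite /= qf qf'; exact: (fiber_square w). Qed.

Definition fiber_map X Y X' Y' Z
    (p : morphism X Z) (q : morphism Y Z) (f : morphism X Y)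
    (p' : morphism X' Z) (q' : morphism Y' Z) (f' : morphism X' Y')
    (qf : forall x, q (f x) = p x) (qf' : forall x, q' (f' x) = p' x) :
  morphism (fiber p p') (fiber q q') :=
  fiber_pair (fiber_map_subproof qf qf').

Definition base_extension X Y Z Z' (p : morphism X Z) (q : morphism Y Z)
    (f : morphism X Y) (qf : forall x, q (f x) = p x) (h : morphism Z' Z) :
  morphism (fiber p h) (fiber q h) :=
  fiber_map (f' := id_morphism Z') (p' := h) (q' := h) qf (fun=> erefl).

Definition restriction X Y (f : morphism X Y) (V : set Y) (dV : dsubset V) :
  morphism (sub_dspace (dsubset_preimage f dV)) (sub_dspace dV) :=
  lift_morphism (f := comp_morphism f (incl_morphism (dsubset_preimage f dV)))
    dV (fun w => set_valP w).

Definition closed_Def X Y (f : morphism X Y) : Prop :=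
  forall A : set X, dsubset A -> closed A -> closed (f @` A).

Definition closed_immersion X Y (f : morphism X Y) : Prop :=
  homeo_onto_image f /\ closed (range f).

Definition separated_Def X Y (f : morphism X Y) : Prop :=
  closed_immersion (diag_morphism f).

Definition universally_closed_Def X Y (f : morphism X Y) : Prop :=
  forall (Y' : dspace M) (g : morphism Y' Y), closed_Def (fiber_pr2 f g).

Definition proper_Def X Y (f : morphism X Y) : Prop :=
  separated_Def f /\ universally_closed_Def f.

End Constructions.

Arguments mfun_continuous {M X Y} m.
Arguments mfun_definable {M X Y} m.

(* Main.v *)
Require Import Defs.
From mathcomp Require Import all_boot all_order all_algebra all_classical.
From mathcomp Require Import topology.

Set Implicit Arguments.
Unset Strict Implicit.
Unset Printing Implicit Defensive.

Local Open Scope classical_set_scope.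

(** A morphism [f] is separated exactly when two distinct points of one fiber
    always have disjoint neighbourhoods ([separated_DefP]), so all statements on
    separatedness reduce to pushing a pair of inseparable points along continuous
    maps.

    For universal closedness there are two formal tools.  Closed morphisms compose
    ([closed_Def_comp]), because images of definable sets under definable maps are
    definable; and if [v' \o w = v] with [w] surjective and [v] closed, then [v']
    is closed ([closed_Def_descend]).  To see that a base change is closed it is
    therefore enough to cover it by a composite of base changes already known to be
    closed.  For a composition [X -> Y -> Z] the cover of [X x_Z T] is
    [X x_Y (Y x_Z T)]; for a product morphism one adds the coordinates one at a
    time; for descent along a surjection [X -> Y] the cover of [Y x_Z T] is
    [X x_Z T]; for a restriction it is a base change of the whole morphism.  Base
    extension is the product with an identity.

    Three arguments use the topology directly: a closed immersion is closed after
    base change because it identifies its source with a closed subspace of the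
    target; if [g] is separated then [X x_Y T] is closed in [X x_Z T], which gives
    cancellation of [g] in [g \o f]; and properness is local on the target because
    closedness of a set can be tested on an open cover. *)

Section Proper.
Context (M : omin_structure).
Implicit Types X Y Z T W : dspace M.

(** * Definable subsets, fiber products and separatedness *)

Lemma dsubset_setT X : dsubset (setT : set X).
Proof. by move=> i; rewrite setTI; exact: ds_chart_def. Qed.

(** In charts the image is a projection of the graph, and definability is closed
    under existential quantification.  This is what lets closed morphisms
    compose: the image of the first must again be a definable set. *)
Lemma dsubset_image X Y (f : morphism X Y) (A : set X) :
  dsubset A -> dsubset (f @` A).
Proof.
move=> dA j; apply: (@mdefinable_by _ _ _ (fun w => exists i : ds_index X,
  exists b, (ds_chart i @` (A `&` ds_dom i)) b /\
  ((fun x => row_mx (ds_chart i x) (ds_chart j (f x)))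
     @` (ds_dom i `&` f @^-1` ds_dom j)) (row_mx b w))).
  move=> w; split.
    move=> [i [b [[x [Ax ix] xb] [x' [ix' jfx'] /eq_row_mx[x'b <-]]]]].
    have e : x = x' by apply: (chart_inj ix ix'); rewrite xb x'b.
    by exists (f x') => //; split => //; exists x' => //; rewrite -e.
  move=> [y [[x Ax xy] jy] <-]; have [i ix] := in_some_chart x.
  by exists i, (ds_chart i x); split; exists x; rewrite /preimage /= ?xy.
apply: dpred_exfin => i; apply: dpred_exv; apply: dpredI.
  by apply: (dpred_in (dA i)); coordsel_tac.
by apply: (dpred_in (mfun_definable f i j)); coordsel_tac.
Qed.

Lemma morphism_nbhs X Y (f : morphism X Y) x (V : set Y) :
  nbhs (f x) V -> nbhs x (f @^-1` V).
Proof. exact: (mfun_continuous f x). Qed.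

Lemma closed_morphism_preimage X Y (f : morphism X Y) (B : set Y) :
  closed B -> closed (f @^-1` B).
Proof. by move=> cB; apply: preimage_closed => // x _; exact: mfun_continuous. Qed.

(** [cluster (nbhs x) x'] says that [x] and [x'] have no disjoint
    neighbourhoods; continuous maps cannot separate such a pair. *)
Lemma cluster_morphism X Y (f : morphism X Y) x x' :
  cluster (nbhs x) x' -> cluster (nbhs (f x)) (f x').
Proof.
move=> xx' U V /morphism_nbhs fU /morphism_nbhs fV.
by have [z [Uz Vz]] := xx' _ _ fU fV; exists (f z).
Qed.

Lemma fiber_ext X Y Z (f : morphism X Z) (g : morphism Y Z) (p q : fiber f g) :
  fiber_pr1 f g p = fiber_pr1 f g q -> fiber_pr2 f g p = fiber_pr2 f g q ->
  p = q.
Proof. by move=> e1 e2; apply: val_inj; apply: injective_projections. Qed.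

Lemma fiber_point X Y Z (f : morphism X Z) (g : morphism Y Z) x y :
  f x = g y ->
  exists p : fiber f g, fiber_pr1 f g p = x /\ fiber_pr2 f g p = y.
Proof.
move=> e; have xy : fiber_set f g (x, y) by [].
by exists (SigSub (mem_set xy)).
Qed.

(** The comparison morphisms below all land in a fiber product, and are shown to
    be surjective by lifting each compatible pair. *)
Lemma fiber_surj X Y Z W (f : morphism X Z) (g : morphism Y Z)
    (w : morphism W (fiber f g)) :
  (forall x y, f x = g y ->
     exists z, fiber_pr1 f g (w z) = x /\ fiber_pr2 f g (w z) = y) ->
  range w = setT.
Proof.
move=> sw; rewrite -subTset => p _.
have [z [z1 z2]] := sw _ _ (fiber_square p).
by exists z => //; exact: fiber_ext.
Qed.

Lemma fiber_nbhsP X Y Z (f : morphism X Z) (g : morphism Y Z) (p : fiber f g)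
    (N : set (fiber f g)) :
  nbhs p N <->
  exists U V, [/\ nbhs (fiber_pr1 f g p) U, nbhs (fiber_pr2 f g p) V &
    forall q, U (fiber_pr1 f g q) -> V (fiber_pr2 f g q) -> N q].
Proof.
split.
  move=> /nbhs_set_type[B [[U V] /= [hU hV] UVB] BN]; exists U, V; split => //.
  by move=> q Uq Vq; apply: BN; apply: UVB.
move=> [U [V [/morphism_nbhs hU /morphism_nbhs hV UVN]]].
by apply: filterS (filterI hU hV) => q [Uq Vq]; exact: UVN.
Qed.

(** The diagonal is always a homeomorphism onto its image, with the first
    projection as continuous left inverse, so only its closedness matters; and a
    point of the fiber product lies in the closure of the diagonal exactly when
    its two coordinates have no disjoint neighbourhoods. *)
Lemma separated_DefP X Y (f : morphism X Y) :
  separated_Def f <->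
  forall x x', f x = f x' -> cluster (nbhs x) x' -> x = x'.
Proof.
split=> [[_ cD] x x' e xx'|sf].
  have [p [p1 p2]] := fiber_point e.
  suff [z _ zp] : range (diag_morphism f) p by rewrite -p1 -p2 -zp.
  apply: cD => N /fiber_nbhsP[U [V []]]; rewrite p1 p2 => hU hV UVN.
  have [z [Uz Vz]] := xx' _ _ hU hV.
  by exists (diag_morphism f z); split; [exists z|exact: UVN].
split.
  apply/homeo_onto_imageP; split.
  - by move=> x x' /(congr1 (fiber_pr1 f f)).
  - exact: mfun_continuous.
  - move=> x U xU; exists (fiber_pr1 f f @^-1` U) => //.
    exact: (@morphism_nbhs _ _ (fiber_pr1 f f) (diag_morphism f x)).
move=> p pD; exists (fiber_pr1 f f p) => //.
apply: fiber_ext => //; apply: sf (fiber_square p) _ => U V.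
move=> /morphism_nbhs hU /morphism_nbhs hV.
by have [_ [[z _ <-] [Uz Vz]]] := pD _ (filterI hU hV); exists z.
Qed.

Lemma separated_comp X Y Z (f : morphism X Y) (g : morphism Y Z) :
  separated_Def f -> separated_Def g -> separated_Def (comp_morphism g f).
Proof.
move=> /separated_DefP sf /separated_DefP sg; apply/separated_DefP => x x' e xx'.
by apply: sf => //; apply: sg => //; exact: cluster_morphism.
Qed.

(** * Closed morphisms *)

Lemma closed_Def_comp X Y Z (f : morphism X Y) (g : morphism Y Z) :
  closed_Def f -> closed_Def g -> closed_Def (comp_morphism g f).
Proof.
move=> cf cg A dA cA; have -> : comp_morphism g f @` A = g @` (f @` A).
  by rewrite image_comp.
by apply: cg; [exact: dsubset_image|exact: cf].
Qed.

(** Since [w] is surjective, [v' @` A] is the image under [v] of the closed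
    definable set [w @^-1` A].  This replaces the canonical isomorphisms between
    iterated fiber products: surjectivity of the comparison morphism is all that
    has to be checked, and its inverse need not be constructed. *)
Lemma closed_Def_descend X X' Y (w : morphism X X') (v : morphism X Y)
    (v' : morphism X' Y) :
  (forall x, v' (w x) = v x) -> range w = setT -> closed_Def v -> closed_Def v'.
Proof.
move=> e sw cv A dA cA; have -> : v' @` A = v @` (w @^-1` A).
  rewrite eqEsubset; split=> [_ [x' Ax' <-]|_ [x Ax <-]]; last first.
    by exists (w x).
  have : setT x' by []; rewrite -sw => -[x _ xx'].
  by exists x; rewrite -?e ?xx' // /preimage /= xx'.
by apply: cv; [exact: dsubset_preimage|exact: closed_morphism_preimage].
Qed.

(** * Permanence properties of proper morphisms *)

(** Given [t] in the closure of the projection of [A], closedness of the range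
    provides the only candidate [x] over [g t]; a neighbourhood of [x] is cut out
    by one of [f x] because [f] is an embedding, so [(x, t)] adheres to [A]. *)
Lemma closed_immersion_proper X Y (f : morphism X Y) :
  closed_immersion f -> proper_Def f.
Proof.
move=> [/homeo_onto_imageP[fI _ of_] cf]; split.
  by apply/separated_DefP => x x' /fI.
move=> T g A _ cA t At.
have [x _ xt] : range f (g t).
  apply: cf => V /morphism_nbhs/At[_ [[p Ap <-] Vp]]; exists (g (fiber_pr2 f g p)).
  by split => //; exists (fiber_pr1 f g p) => //; exact: fiber_square.
have [p [p1 p2]] := fiber_point xt.
exists p => //; apply: cA => N /fiber_nbhsP[U [V []]]; rewrite p1 p2.
move=> /of_[V' xV' V'U] hV UVN.
have hV' : nbhs t (g @^-1` V') by apply: morphism_nbhs; rewrite -xt.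
have [_ [[q Aq <-] [Vq V'q]]] := At _ (filterI hV hV').
exists q; split => //; apply: UVN => //; apply: V'U.
by rewrite /preimage /= fiber_square.
Qed.

Lemma id_proper X : proper_Def (id_morphism X).
Proof.
apply: closed_immersion_proper; split; last by rewrite image_id; exact: closedT.
apply/homeo_onto_imageP; split => //; first exact: mfun_continuous.
by move=> x U xU; exists U.
Qed.

(** Universal closedness uses that [X x_Y (Y x_Z T)] maps onto [X x_Z T], while
    its projection to [T] is a base change of [f] followed by one of [g]. *)
Lemma comp_proper X Y Z (f : morphism X Y) (g : morphism Y Z) :
  proper_Def f -> proper_Def g -> proper_Def (comp_morphism g f).
Proof.
move=> [sf cf] [sg cg]; split; first exact: separated_comp.
move=> T h; set gh := fiber_pr1 g h.
have e (p : fiber f gh) : comp_morphism g f (fiber_pr1 f gh p) =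
    h (comp_morphism (fiber_pr2 g h) (fiber_pr2 f gh) p).
  by rewrite /= -fiber_square -(fiber_square p).
apply: (closed_Def_descend (w := fiber_pair (f := comp_morphism g f) (g := h)
  (u := fiber_pr1 f gh) (v := comp_morphism (fiber_pr2 g h) (fiber_pr2 f gh)) e)
  (v := comp_morphism (fiber_pr2 g h) (fiber_pr2 f gh))) => //.
  apply: fiber_surj => x t xt.
  have [q [q1 q2]] := fiber_point (xt : g (f x) = h t).
  have [p [p1 p2]] := fiber_point (f := f) (g := gh) (esym q1).
  by exists p; split => //; rewrite -q2 -p2.
by apply: closed_Def_comp; [exact: cf|exact: cg].
Qed.

(** A point of the base change of [f x f'] along [h : T -> Y x_Z Y'] is a triple
    [(x, x', t)] with [f x = h1 t] and [f' x' = h2 t], where [h1] and [h2] are the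
    two components of [h].  Forgetting [x] is a base change of [f] and then
    forgetting [x'] is a base change of [f']. *)
Lemma fiber_map_proper X Y X' Y' Z
    (p : morphism X Z) (q : morphism Y Z) (f : morphism X Y)
    (qf : forall x, q (f x) = p x)
    (p' : morphism X' Z) (q' : morphism Y' Z) (f' : morphism X' Y')
    (qf' : forall x, q' (f' x) = p' x) :
  proper_Def f -> proper_Def f' -> proper_Def (fiber_map qf qf').
Proof.
move=> [sf cf] [sf' cf']; split.
  move/separated_DefP in sf; move/separated_DefP in sf'.
  apply/separated_DefP => a b ab cl; apply: fiber_ext.
    by apply: sf; [exact: (congr1 (fiber_pr1 q q') ab)|exact: cluster_morphism].
  by apply: sf'; [exact: (congr1 (fiber_pr2 q q') ab)|exact: cluster_morphism].
move=> T h.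
set h1 := comp_morphism (fiber_pr1 q q') h.
set h2 := comp_morphism (fiber_pr2 q q') h.
set k := comp_morphism h1 (fiber_pr2 f' h2).
have e (a : fiber f k) : p (fiber_pr1 f k a) =
    p' (comp_morphism (fiber_pr1 f' h2) (fiber_pr2 f k) a).
  rewrite -qf (fiber_square a) /= -qf' (fiber_square (fiber_pr2 f k a)) /=.
  exact: fiber_square.
pose u := fiber_pair (f := p) (g := p') (u := fiber_pr1 f k)
  (v := comp_morphism (fiber_pr1 f' h2) (fiber_pr2 f k)) e.
pose v := comp_morphism (fiber_pr2 f' h2) (fiber_pr2 f k).
have e' a : fiber_map qf qf' (u a) = h (v a).
  apply: fiber_ext; first exact: (fiber_square a).
  exact: (fiber_square (fiber_pr2 f k a)).
apply: (closed_Def_descend (w := fiber_pair (f := fiber_map qf qf') (g := h)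
  (u := u) (v := v) e') (v := v)) => //.
  apply: fiber_surj => z t zt.
  have zt2 : f' (fiber_pr2 p p' z) = h2 t := congr1 (fiber_pr2 q q') zt.
  have [b [b1 b2]] := fiber_point zt2.
  have zt1 : f (fiber_pr1 p p' z) = k b.
    rewrite [RHS](congr1 h1 b2); exact: (congr1 (fiber_pr1 q q') zt).
  have [a [a1 a2]] := fiber_point zt1.
  exists a; split; last by rewrite -b2 -a2.
  by apply: fiber_ext; [rewrite -a1|rewrite -b1 -a2].
by apply: closed_Def_comp; [exact: cf|exact: cf'].
Qed.

(** As [g] is separated, the inclusion [j] of [X x_Y T] into [X x_Z T] is closed:
    at an adherent point [(x, t)] the points [f x] and [h t] have the same image
    in [Z] and no disjoint neighbourhoods, hence are equal.  The projection of
    [X x_Y T] to [T] is [j] followed by the projection of [X x_Z T]. *)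
Lemma proper_cancel_left X Y Z (f : morphism X Y) (g : morphism Y Z) :
  proper_Def (comp_morphism g f) -> separated_Def g -> proper_Def f.
Proof.
move=> [sgf cgf] /separated_DefP sg; split.
  move/separated_DefP in sgf; apply/separated_DefP => x x' e.
  by apply: sgf; rewrite /= e.
move=> T h; set gf := comp_morphism g f; set gh := comp_morphism g h.
have e (p : fiber f h) : gf (fiber_pr1 f h p) = gh (fiber_pr2 f h p).
  by rewrite /gf /gh /= fiber_square.
pose j := fiber_pair (f := gf) (g := gh) (u := fiber_pr1 f h)
  (v := fiber_pr2 f h) e.
(* [j] and the next projection compose to [fiber_pr2 f h] up to conversion. *)
suff cj : closed_Def j.
  have := closed_Def_comp cj (cgf T gh).
  by move=> c A dA cA; exact: (c A dA cA).
move=> A _ cA a Aa.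
have ha : f (fiber_pr1 gf gh a) = h (fiber_pr2 gf gh a).
  (* Neighbourhoods of [f x] and [h t] pull back to one of [a], which meets the
     image of [X x_Y T]; a common point gives a common point downstairs. *)
  apply: sg; first exact: (fiber_square a).
  move=> U V /morphism_nbhs/morphism_nbhs hU /morphism_nbhs/morphism_nbhs hV.
  have [_ [[p Ap <-] [Up Vp]]] := Aa _ (filterI hU hV).
  exists (f (fiber_pr1 f h p)); split; first exact: Up.
  by rewrite fiber_square; exact: Vp.
have [p [p1 p2]] := fiber_point ha.
exists p; last by apply: fiber_ext; [rewrite -p1|rewrite -p2].
apply: cA => N /fiber_nbhsP[U [V []]]; rewrite p1 p2.
move=> /morphism_nbhs hU /morphism_nbhs hV UVN.
have [_ [[r Ar <-] [Ur Vr]]] := Aa _ (filterI hU hV).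
by exists r; split => //; exact: UVN.
Qed.

(** [X x_Z T] maps onto [Y x_Z T] over [T], because [f] is surjective. *)
Lemma proper_cancel_right X Y Z (f : morphism X Y) (g : morphism Y Z) :
  proper_Def (comp_morphism g f) -> separated_Def g -> range f = setT ->
  proper_Def g.
Proof.
move=> [_ cgf] sg sf; split => // T h.
set gf := comp_morphism g f.
have e (p : fiber gf h) : g (comp_morphism f (fiber_pr1 gf h) p) =
    h (fiber_pr2 gf h p) by exact: (fiber_square p).
apply: (closed_Def_descend (w := fiber_pair (f := g) (g := h)
  (u := comp_morphism f (fiber_pr1 gf h)) (v := fiber_pr2 gf h) e)
  (v := fiber_pr2 gf h)) => //.
apply: fiber_surj => y t yt.
have : setT y by []; rewrite -sf => -[x _ xy].
have [p [p1 p2]] : exists p, fiber_pr1 gf h p = x /\ fiber_pr2 gf h p = t.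
  by apply: fiber_point; rewrite /gf /= xy.
by exists p; split; rewrite -?xy -?p1.
Qed.

(** Over a test morphism [T -> V] the base change of the restriction is covered
    by the base change of [f] along [T -> V -> Y]. *)
Lemma restriction_proper X Y (f : morphism X Y) (V : set Y) (dV : dsubset V) :
  proper_Def f -> proper_Def (restriction f dV).
Proof.
move=> [/separated_DefP sf cf]; split.
  apply/separated_DefP => x x' e xx'; apply: val_inj; apply: sf.
    exact: (congr1 set_val e).
  exact: (cluster_morphism (f := incl_morphism (dsubset_preimage f dV))).
move=> T h; pose ih := comp_morphism (incl_morphism dV) h.
have fV (p : fiber f ih) : (f @^-1` V) (fiber_pr1 f ih p).
  by rewrite /preimage /= (fiber_square p); exact: set_valP.
have e (p : fiber f ih) : restriction f dV
    (lift_morphism (dsubset_preimage f dV) fV p) = h (fiber_pr2 f ih p).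
  by apply: val_inj; exact: (fiber_square p).
apply: (closed_Def_descend (w := fiber_pair (f := restriction f dV) (g := h)
  (u := lift_morphism (dsubset_preimage f dV) fV) (v := fiber_pr2 f ih) e)
  (v := fiber_pr2 f ih)) => //.
apply: fiber_surj => x t xt.
have [p [p1 p2]] := fiber_point (f := f) (g := ih) (congr1 set_val xt).
by exists p; split => //; apply: val_inj.
Qed.

Lemma nbhs_open_val (S : topologicalType) (A : set S) (a : A) (N : set A) :
  open A -> nbhs a N -> nbhs (set_val a) (set_val @` N).
Proof.
move=> oA /nbhs_set_type[V aV VN].
have aA : nbhs (set_val a) A.
  by apply: open_nbhs_nbhs; split => //; exact: set_valP.
apply: filterS (filterI aV aA) => x [Vx Ax].
by exists (SigSub (mem_set Ax)) => //; exact: VN.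
Qed.

(** Both halves are local on the target.  Two inseparable points of a fiber lie in
    one [f @^-1` V i], and being open it does not separate them either.  A point
    [t] in the closure of the projection of [A] lies in some [h @^-1` V i]; this is
    open, so [t] is also adherent within it, where the base change of the
    restriction applies to the trace of [A]. *)
Lemma proper_local X Y (f : morphism X Y) (I : Type) (V : I -> set Y)
    (dV : forall i, dsubset (V i)) :
  (forall i, open (V i)) -> \bigcup_i V i = setT ->
  (forall i, proper_Def (restriction f (dV i))) -> proper_Def f.
Proof.
move=> oV cV pf.
have inV y : exists i, V i y.
  by have : setT y by []; rewrite -cV => -[i _]; exists i.
split.
  apply/separated_DefP => x x' e xx'; have [i Vx] := inV (f x).
  have Vx' : V i (f x') by rewrite -e.
  have [/separated_DefP si _] := pf i.
  have oW : open (f @^-1` V i).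
    by apply: open_comp => // z _; exact: mfun_continuous.
  pose W := sub_dspace (dsubset_preimage f (dV i)).
  pose z : W := SigSub (mem_set (Vx : (f @^-1` V i) x)).
  pose z' : W := SigSub (mem_set (Vx' : (f @^-1` V i) x')).
  apply: (congr1 set_val (_ : z = z')).
  apply: si; first exact: val_inj.
  move=> P Q /(nbhs_open_val oW) hP /(nbhs_open_val oW) hQ.
  have [_ [[s Ps <-] [s' Qs' /val_inj ss']]] := xx' _ _ hP hQ.
  by exists s; split => //; rewrite -ss'.
move=> T h A dA cA t At; have [i Vt] := inV (h t).
set fi := restriction f (dV i); set hi := restriction h (dV i).
have [_ ci] := pf i.
pose a := incl_morphism (dsubset_preimage f (dV i)).
pose b := incl_morphism (dsubset_preimage h (dV i)).
have e (p : fiber fi hi) : f (comp_morphism a (fiber_pr1 fi hi) p) =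
    h (comp_morphism b (fiber_pr2 fi hi) p).
  exact: (congr1 set_val (fiber_square p)).
pose j := fiber_pair (f := f) (g := h) (u := comp_morphism a (fiber_pr1 fi hi))
  (v := comp_morphism b (fiber_pr2 fi hi)) e.
(* The trace of [A] over [V i], and [t] seen as a point of the open part. *)
have [p Ap pt] : (fiber_pr2 fi hi @` (j @^-1` A))
    (SigSub (mem_set (Vt : (h @^-1` V i) t))).
  apply: ci; [exact: dsubset_preimage|exact: closed_morphism_preimage|].
  have oW : open (h @^-1` V i).
    by apply: open_comp => // z _; exact: mfun_continuous.
  move=> N /(nbhs_open_val oW)/At[_ [[q Aq <-] [s Ns sq]]].
  have Vq : V i (f (fiber_pr1 f h q)).
    by rewrite fiber_square -sq; exact: (set_valP s).
  have [r [r1 r2]] : exists r : fiber fi hi,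
      fiber_pr1 fi hi r = SigSub (mem_set (Vq : (f @^-1` V i) _)) /\
      fiber_pr2 fi hi r = s.
    apply: fiber_point; apply: val_inj.
    by rewrite [LHS]fiber_square -sq.
  have rq : j r = q.
    apply: fiber_ext; first by rewrite [LHS](congr1 set_val r1).
    by rewrite [LHS](congr1 set_val r2).
  by exists s; split => //; exists r => //; rewrite -rq in Aq.
by exists (j p) => //; exact: (congr1 set_val pt).
Qed.

End Proper.

Theorem proposition3p7 (M : omin_structure) :
  (* (1) *)
  (forall (X Y : dspace M) (f : morphism X Y),
     closed_immersion f -> proper_Def f) /\
  (* (2) *)
  (forall (X Y Z : dspace M) (f : morphism X Y) (g : morphism Y Z),
     proper_Def f -> proper_Def g -> proper_Def (comp_morphism g f)) /\
  (* (3) *)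
  (forall (X Y Z Z' : dspace M) (p : morphism X Z) (q : morphism Y Z)
     (f : morphism X Y) (qf : forall x : X, q (f x) = p x)
     (h : morphism Z' Z),
     proper_Def f -> proper_Def (base_extension qf h)) /\
  (* (4) *)
  (forall (X Y X' Y' Z : dspace M)
     (p : morphism X Z) (q : morphism Y Z) (f : morphism X Y)
     (qf : forall x : X, q (f x) = p x)
     (p' : morphism X' Z) (q' : morphism Y' Z) (f' : morphism X' Y')
     (qf' : forall x : X', q' (f' x) = p' x),
     proper_Def f -> proper_Def f' -> proper_Def (fiber_map qf qf')) /\
  (* (5); the hypothesis that g is separated is required in part (i) as well:
     without it (i) fails, e.g. for the line with a doubled point *)
  (forall (X Y Z : dspace M) (f : morphism X Y) (g : morphism Y Z),
     proper_Def (comp_morphism g f) ->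
     (separated_Def g -> proper_Def f) /\
     (separated_Def g -> range f = setT -> proper_Def g)) /\
  (* (6) *)
  (forall (X Y : dspace M) (f : morphism X Y),
     proper_Def f <->
     exists (I : finType) (V : I -> set Y) (dV : forall i, dsubset (V i)),
       [/\ forall i, open (V i), \bigcup_i V i = setT &
           forall i, proper_Def (restriction f (dV i))]).
Proof.
split; first exact: closed_immersion_proper.
split; first exact: comp_proper.
split.
  move=> X Y Z Z' p q f qf h pf.
  by apply: fiber_map_proper => //; exact: id_proper.
split; first exact: fiber_map_proper.
split.
  move=> X Y Z f g pgf; split; first exact: proper_cancel_left.
  exact: proper_cancel_right.
move=> X Y f; split=> [pf|[I [V [dV [oV cV pV]]]]]; last exact: proper_local pV.
exists unit, (fun=> setT), (fun=> @dsubset_setT M Y); split.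
- by move=> _; exact: openT.
- by rewrite -subTset => y _; exists tt.
- by move=> _; exact: restriction_proper.
Qed.
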